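(* For every integer $n\ge 0$, with $z_{n,k}$, $1\le k\le \frac12 n(n+1)$, the (distinct) complex roots of the Yablonskii--Vorob'ev polynomial $Q_n$, the following hold: $$\sum_{k=1,\; z_{n,k}\neq 0}^{\frac{1}{2}n(n+1)}\frac{1}{z_{n,k}^3}=\begin{cases} \dfrac{n}{4}& \text{if } n\equiv 0 \pmod{3},\\[2mm] 0& \text{if } n\equiv 1 \pmod{3},\\[2mm] -\dfrac{n+1}{4}& \text{if } n\equiv 2 \pmod{3},\end{cases}$$ $$\sum_{k=1,\; z_{n,k}\neq 0}^{\frac{1}{2}n(n+1)}\frac{1}{z_{n,k}^6}=\begin{cases} \dfrac{1}{40}n^2+\dfrac{1}{80}n& \text{if } n\equiv 0 \pmod{3},\\[2mm] -\dfrac{1}{560}n^2-\dfrac{1}{560}n+\dfrac{1}{280}& \text{if } n\equiv 1 \pmod{3},\\[2mm] \dfrac{1}{40}n^2+\dfrac{3}{80}n+\dfrac{1}{80}& \text{if } n\equiv 2 \pmod{3},\end{cases}$$ $$\sum_{k=1,\; z_{n,k}\neq 0}^{\frac{1}{2}n(n+1)}\frac{1}{z_{n,k}^9}=\begin{cases} \dfrac{n+7n^2+10n^3}{4480}& \text{if } n\equiv 0 \pmod{3},\\[2mm] \dfrac{2-n-n^2}{22400}& \text{if } n\equiv 1 \pmod{3},\\[2mm] \dfrac{-20-85n-115n^2-50n^3}{22400}& \text{if } n\equiv 2 \pmod{3}.\end{cases}$$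
   Context: The Yablonskii--Vorob'ev polynomials $Q_n$ ($n\ge 0$) are defined by $Q_0=1$, $Q_1=z$ and the differential-difference equation $Q_{n+1}Q_{n-1}=zQ_n^2-4\left(Q_nQ_n''-(Q_n')^2\right)$ for $n\ge1$, where $'$ denotes $d/dz$. It is known that each $Q_n$ is a monic polynomial in $z$ of degree $\frac12 n(n+1)$ with integer coefficients, and (Fukutani, Okamoto, Umemura) that all roots of $Q_n$ are simple, so $Q_n$ has exactly $\frac12 n(n+1)$ distinct complex roots $z_{n,k}$. The sums run over the nonzero roots only; empty sums are $0$. *)

(* Defs.v *)
From mathcomp Require Import all_boot all_order all_algebra.

Set Implicit Arguments.
Unset Strict Implicit.
Unset Printing Implicit Defensive.

Import GRing.Theory.
Local Open Scope ring_scope.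

(* The recurrence determines the sequence: comparing degrees shows inductively *)
(* that no Q n is zero, so Q n.+1 is determined by Q n and Q n.-1.             *)
Definition Yablonskii_Vorobev (K : fieldType) (Q : nat -> {poly K}) : Prop :=
  [/\ Q 0%N = 1,
      Q 1%N = 'X &
      forall n : nat, (1 <= n)%N ->
        Q n.+1 * Q n.-1 =
          'X * Q n ^+ 2 - 4 *: (Q n * (Q n)^`(2) - (Q n)^`() ^+ 2)].

(* [z] lists each root of [p] exactly once, whatever its multiplicity. *)
Definition enumerates_roots (K : fieldType) (p : {poly K}) (z : seq K) : Prop :=
  uniq z /\ forall x : K, (x \in z) = root p x.

Definition inverse_power_sum (K : fieldType) (z : seq K) (m : nat) : K :=
  \sum_(x <- z | x != 0) 1 / x ^+ m.

(* Main.v *)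
(* By induction, the recurrence implies two bilinear identities:
   [Q_(n+1)'' Q_n - 2 Q_(n+1)' Q_n' + Q_(n+1) Q_n'' = 0] and
   [Q_(n+1)' Q_(n-1) - Q_(n+1) Q_(n-1)' = (2n+1) Q_n^2]. The second one excludes
   multiple roots. The first one is linear in [Q_(n+1)] and, apart from its
   indicial exponents, determines the Taylor coefficients of [Q_(n+1)] at [0] from
   those of [Q_n] to the same relative order; the coefficients at the indicial
   exponents come from the recurrence. This gives closed forms for
   [e3], [e6], [e9] in [Q_n = c z^m (1 + e3 z^3 + e6 z^6 + e9 z^9 + O(z^10))], by
   induction on [n] in blocks of three, and Newton's identities convert them into
   the power sums. *)
Require Import Defs.
From mathcomp Require Import all_boot all_order all_algebra.
From mathcomp Require Import reals complex.
From mathcomp Require Import separable.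
From mathcomp Require Import ring.

Set Implicit Arguments.
Unset Strict Implicit.
Unset Printing Implicit Defensive.

Import GRing.Theory Num.Theory.
Local Open Scope ring_scope.

(** * Bilinear identities and simplicity of the roots *)

Definition hirota2 (K : fieldType) (p q : {poly K}) : {poly K} :=
  p^`()^`() * q - 2 * (p^`() * q^`()) + p * q^`()^`().

Lemma deriv_natrM (K : nzRingType) (k : nat) (p : {poly K}) :
  (k%:R * p)^`() = k%:R * p^`().
Proof. by rewrite !mulr_natl derivMn. Qed.

(** Induction step for both bilinear identities, with [A], [B], [C], [E] in the role of four
    consecutive polynomials. *)
Lemma toda_step (K : fieldType) (A B C E : {poly K}) (n : nat) :
    B != 0 ->
    C * A = 'X * B ^+ 2 - 4 * (B * B^`()^`() - B^`() ^+ 2) ->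
    E * B = 'X * C ^+ 2 - 4 * (C * C^`()^`() - C^`() ^+ 2) ->
    C^`() * A - C * A^`() = (2 * n + 1)%:R * B ^+ 2 ->
    hirota2 C B = 0 ->
  E^`() * B - E * B^`() = (2 * n.+1 + 1)%:R * C ^+ 2 /\ hirota2 E C = 0.
Proof.
move=> B0 TB TC DB; rewrite /hirota2 => HB.
have TB' := congr1 (@deriv K) TB.
have TC' := congr1 (@deriv K) TC.
have HB' := congr1 (@deriv K) HB.
rewrite !(derivD, derivN, deriv_natrM, derivM, expr2, derivX, deriv0) in TB' TC' HB'.
have DC : E^`() * B - E * B^`() = (2 * n.+1 + 1)%:R * C ^+ 2.
  (* After division by [(BC)^2] the two sides differ by [-4 b'], where
     [b = hirota2 C B / (BC)]. *)
  apply/(mulfI (mulf_neq0 B0 B0))/subr0_eq.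
  set W := LHS.
  (* Regrouped so that [E] and [A] enter only through [E * B], [C * A], their derivatives and the
     known Wronskian of [C] and [A]; what remains after substitution involves [B] and [C] alone. *)
  have {W}-> : W = B * (B * (E^`() * B + E * B^`()) - 2 * B^`() * (E * B))
      - C * (2 * C^`() * (C * A) - C * (C^`() * A + C * A^`()))
      - 2 * B ^+ 2 * C ^+ 2
      + C ^+ 2 * (C^`() * A - C * A^`() - (2 * n + 1)%:R * B ^+ 2).
    by rewrite /W; ring.
  rewrite DB TB' TC' TB TC.
  set h := LHS in HB; set h' := LHS in HB'.
  transitivity (- 4 * (h' * (B * C) - h * (B^`() * C + B * C^`()))).
    by rewrite /h /h'; ring.
  by rewrite HB HB'; ring.
split=> //.
have DC' := congr1 (@deriv K) DC.
rewrite [RHS]deriv_natrM !(derivD, derivN, deriv_natrM, derivM, expr2) in DC'.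
apply: (mulfI B0); apply: subr0_eq.
set h := LHS in HB.
(* This is [E h + C W' - 2 C' W] with [W = E' B - E B']. Since [W] is a constant multiple of
   [C ^+ 2], the last two terms cancel. *)
transitivity (E * h
   + C * (E^`()^`() * B + E^`() * B^`() - (E^`() * B^`() + E * B^`()^`()))
   - 2 * C^`() * (E^`() * B - E * B^`())).
  by rewrite /h; ring.
by rewrite DC' DC HB; ring.
Qed.

Lemma YV_toda (K : fieldType) (Q : nat -> {poly K}) (n : nat) :
    Yablonskii_Vorobev Q ->
  Q n.+2 * Q n = 'X * Q n.+1 ^+ 2
    - 4 * (Q n.+1 * (Q n.+1)^`()^`() - (Q n.+1)^`() ^+ 2).
Proof. by case=> _ _ /(_ n.+1 isT) /= ->; rewrite -mul_polyC polyC_natr. Qed.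

Lemma YV_bilinear (K : numFieldType) (Q : nat -> {poly K}) (n : nat) :
    Yablonskii_Vorobev Q ->
  [/\ Q n != 0, Q n.+1 != 0,
      (Q n.+2)^`() * Q n - Q n.+2 * (Q n)^`() = (2 * n.+1 + 1)%:R * Q n.+1 ^+ 2
    & hirota2 (Q n.+2) (Q n.+1) = 0].
Proof.
move=> hQ; have [Q0 Q1 _] := hQ.
(* If [p] were 0, an odd multiple of [q ^+ 2] would vanish, which characteristic 0 forbids. This
   keeps the [B != 0] of [toda_step] available. *)
have nz m (p q r : {poly K}) :
    p^`() * r - p * r^`() = (2 * m + 1)%:R * q ^+ 2 -> q != 0 -> p != 0.
  move=> e q0; apply: contraNneq q0 => p0; move/esym/eqP: e.
  rewrite p0 deriv0 !mul0r subr0 mulf_eq0 expf_eq0 /= -polyC_natr polyC_eq0.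
  by rewrite pnatr_eq0 addn1.
elim: n => [|n [n0 n1 D B]].
  have d4 : (4 : {poly K})^`() = 0 by rewrite -polyC_natr derivC.
  have Q2 : Q 2 = 'X ^+ 3 + 4.
    have := YV_toda 0 hQ.
    by rewrite Q0 Q1 mulr1 derivX -polyC1 derivC => ->; ring.
  rewrite Q0 Q1 /hirota2 Q2 !exprS expr0.
  split; rewrite ?oner_eq0 ?polyX_eq0 //.
    rewrite !(derivD, derivM, derivX, d4) -polyC1 derivC; ring.
  rewrite !(derivD, derivM, derivX, d4) -polyC1 !derivC; ring.
have n2 := nz _ _ _ _ D n1.
by have [] := toda_step n1 (YV_toda n hQ) (YV_toda n.+1 hQ) D B.
Qed.

Lemma YV_hirota2 (K : numFieldType) (Q : nat -> {poly K}) (n : nat) :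
  Yablonskii_Vorobev Q -> hirota2 (Q n.+1) (Q n) = 0.
Proof.
case: n => [|n] hQ; last by have [] := YV_bilinear n hQ.
by have [-> -> _] := hQ; rewrite /hirota2 derivX -polyC1 !derivC; ring.
Qed.

(** The two claims feed each other. At a double root of [Q n.+2] the Wronskian identity makes
    [Q n.+1] vanish too, against coprimality; at a common root of [Q n.+2] and [Q n.+1] the
    recurrence reduces to [4 (Q n.+1)'^2 = 0], a double root of [Q n.+1]. *)
Lemma YV_coprime_simple (K : numFieldType) (Q : nat -> {poly K}) (n : nat)
    (x : K) : Yablonskii_Vorobev Q ->
  ~~ (root (Q n.+1) x && root (Q n) x) /\
  ~~ (root (Q n) x && root (Q n)^`() x).
Proof.
move=> hQ; have [Q0 Q1 _] := hQ.
elim: n => [|n [copr simple]].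
  by rewrite Q0 (negPf (root1 _)) andbF.
have [_ _ D _] := YV_bilinear n hQ.
have simple1 : ~~ (root (Q n.+1) x && root (Q n.+1)^`() x).
  case: n D copr simple => [|n] D copr simple.
    by rewrite Q1 derivX (negPf (root1 _)) andbF.
  have [_ _ {}D _] := YV_bilinear n hQ; rewrite -polyC_natr in D.
  apply: contra copr => /andP[/rootP r0 /rootP r1].
  have := congr1 (horner^~ x) D.
  rewrite hornerD hornerN !(horner_exp, hornerM, hornerC) r0 r1 !mul0r subr0 => /esym/eqP.
  rewrite mulf_eq0 pnatr_eq0 addn1 /= expf_eq0 /= => r2.
  by apply/andP; split=> //; apply/rootP.
split=> //.
apply: contra simple1 => /andP[/rootP r2 /rootP r1].
have := congr1 (horner^~ x) (YV_toda n hQ).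
rewrite -polyC_natr !(hornerD, hornerN, horner_exp, hornerM, hornerC) r1 r2.
rewrite expr0n /= !(mul0r, mulr0) !sub0r mulrN opprK => /esym/eqP.
rewrite mulf_eq0 pnatr_eq0 /= expf_eq0 /= => r3; apply/andP; split; [exact/rootP|exact: r3].
Qed.

(** * Coefficient form of the two equations *)

Lemma coef_Xderiv (K : nzRingType) (p : {poly K}) (i : nat) :
  ('X * p^`())`_i = i%:R * p`_i.
Proof.
by rewrite coefXM; case: i => [|i]; rewrite ?mul0r // coef_deriv mulr_natl.
Qed.

(** The Euler operator [E = X d/dX] is diagonal on monomials and [X^2 p'' = E (E p) - E p]. So the
    pair [i + j = k + 2] has weight [i(i-1) + j(j-1) - 2ij = (i-j)^2 - (i+j)]. *)
Lemma coef_hirota2 (K : fieldType) (p q : {poly K}) (k : nat) :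
  (hirota2 p q)`_k = \sum_(0 <= i < k.+3)
     ((i%:R - (k.+2 - i)%:R) ^+ 2 - k.+2%:R) * p`_i * q`_(k.+2 - i).
Proof.
pose E (r : {poly K}) := 'X * r^`().
have -> : (hirota2 p q)`_k = ('X^2 * hirota2 p q)`_k.+2.
  by rewrite coefXnM subn2.
have -> : 'X^2 * hirota2 p q =
    (E (E p) - E p) * q + p * (E (E q) - E q) - (E p * E q + E p * E q).
  by rewrite /hirota2 /E !derivM derivX; ring.
rewrite coefB !coefD !coefM -!big_split -sumrB big_mkord /=.
apply: eq_bigr => i _; rewrite !coefB !coef_Xderiv.
have -> : k.+2%:R = i%:R + (k.+2 - i)%:R :> K.
  by rewrite -natrD subnKC // -ltnS.
ring.
Qed.

Lemma coef_toda (K : fieldType) (p : {poly K}) (k : nat) :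
  ('X * p ^+ 2 - 4 * (p * p^`()^`() - p^`() ^+ 2))`_k =
    \sum_(0 <= i < k) p`_i * p`_(k.-1 - i)
    - 4 * \sum_(0 <= i < k.+3)
       i%:R * (i%:R - 1 - (k.+2 - i)%:R) * p`_i * p`_(k.+2 - i).
Proof.
pose E (r : {poly K}) := 'X * r^`().
rewrite coefB; congr (_ - _).
  rewrite coefXM; case: k => [|k]; first by rewrite big_geq.
  by rewrite expr2 coefM big_mkord.
rewrite [in LHS]mulr_natl coefMn mulr_natl; congr (_ *+ _).
have -> r : (r : {poly K})`_k = ('X^2 * r)`_k.+2 by rewrite coefXnM subn2.
have -> : 'X^2 * (p * p^`()^`() - p^`() ^+ 2) = (E (E p) - E p) * p - E p * E p.
  by rewrite /E !derivM derivX; ring.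
rewrite coefB !coefM -sumrB big_mkord /=.
apply: eq_bigr => i _; rewrite !coefB !coef_Xderiv.
ring.
Qed.

Lemma toda_coefs (K : fieldType) (A B C : {poly K}) (k : nat) :
    C * A = 'X * B ^+ 2 - 4 * (B * B^`()^`() - B^`() ^+ 2) ->
  \sum_(0 <= i < k.+1) C`_i * A`_(k - i) =
    \sum_(0 <= i < k) B`_i * B`_(k.-1 - i)
    - 4 * \sum_(0 <= i < k.+3)
       i%:R * (i%:R - 1 - (k.+2 - i)%:R) * B`_i * B`_(k.+2 - i).
Proof. by move=> T; rewrite -coef_toda -T coefM big_mkord. Qed.

Lemma hirota2_coefs (K : fieldType) (B C : {poly K}) (k : nat) :
    hirota2 C B = 0 ->
  \sum_(0 <= i < k.+3)
     ((i%:R - (k.+2 - i)%:R) ^+ 2 - k.+2%:R) * C`_i * B`_(k.+2 - i) = 0.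
Proof. by move=> H; rewrite -coef_hirota2 H coef0. Qed.

(** * Propagation of Taylor expansions at 0 from one polynomial to the next *)

Lemma solve_for (K : fieldType) (w u v l r : K) :
  l = r -> w != 0 -> w * (u - v) = l - r -> u = v.
Proof.
by move=> -> w0 /eqP; rewrite subrr mulf_eq0 (negPf w0) subr_eq0 => /eqP.
Qed.

(* [p = c X^m (1 + e3 X^3 + e6 X^6 + e9 X^9) + O(X^(m + 10))] with [c != 0]. *)
Definition expansion (K : fieldType) (m : nat) (e3 e6 e9 : K) (p : {poly K}) :=
  exists2 c, c != 0 & forall i, (i < m + 10)%N ->
    p`_i = c * nth 0 (nseq m 0 ++ [:: 1; 0; 0; e3; 0; 0; e6; 0; 0; e9]) i.

(* Solves for an unknown that occurs in the equation [E] linearly, with leading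
   coefficient [w], after substituting the coefficients known so far. *)
Ltac solve_coef E w :=
  have := E; rewrite unlock /= ?(subSS, subn0, subnn);
  repeat match goal with
  | h : nth _ (polyseq _) _ = _ |- _ => rewrite h
  | h : _ (S _) = _ |- _ => rewrite h
  end;
  rewrite ?(mulr0, mul0r);
  repeat match goal with
  | h : forall i, _ -> nth _ (polyseq _) i = _ |- _ => rewrite h //
  end;
  rewrite /= ?(mulr1, mulr0);
  let e := fresh "e" in move=> e; apply: (solve_for (w := w) e);
  [ by rewrite ?oppr_eq0 ?mulf_neq0 ?pnatr_eq0
  | field; rewrite ?mulf_neq0 ?pnatr_eq0 // ].

(** The unknown [C_j] meets [B_0] with weight [j(j-1)]. The indicial exponents are 0 and 1, so [C_0]
    and [C_1] are data. *)
Lemma expansion_step0 (K : numFieldType) (e3 e6 e9 : K) (B C : {poly K}) :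
    expansion 0 e3 e6 e9 B -> hirota2 C B = 0 -> C`_0 = 0 -> C`_1 != 0 ->
  expansion 1 0 (- (3 / 7 * e6)) ((3 / 7 * e6 * e3 - 9 * e9) / 15) C.
Proof.
move=> [b b0 hB] H C0; move C1: (C`_1) => c c0.
have C2 : C`_2 = 0 by solve_coef (hirota2_coefs 0 H) (2 * b).
have C3 : C`_3 = 0 by solve_coef (hirota2_coefs 1 H) (6 * b).
(* The product of [C_1] and [B_3] has weight [(1-3)^2 - 4 = 0], so [e3] does not enter. *)
have C4 : C`_4 = 0 by solve_coef (hirota2_coefs 2 H) (12 * b).
have C5 : C`_5 = 0 by solve_coef (hirota2_coefs 3 H) (20 * b).
have C6 : C`_6 = 0 by solve_coef (hirota2_coefs 4 H) (30 * b).
have C7 : C`_7 = c * - (3 / 7 * e6) by solve_coef (hirota2_coefs 5 H) (42 * b).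
have C8 : C`_8 = 0 by solve_coef (hirota2_coefs 6 H) (56 * b).
have C9 : C`_9 = 0 by solve_coef (hirota2_coefs 7 H) (72 * b).
have C10 : C`_10 = c * ((3 / 7 * e6 * e3 - 9 * e9) / 15).
  by solve_coef (hirota2_coefs 8 H) (90 * b).
exists c => //; do 11?[case=> [_|]]; last by [].
all: rewrite /= ?(C0, C1, C2, C3, C4, C5, C6, C7, C8, C9, C10).
all: by rewrite ?(mulr1, mulr0).
Qed.

(** Now [C_j] meets [B_1] with weight [(j-1)^2 - (j+1) = j(j-3)]: the indicial exponents are 0 and
    3, so [f3] has to be supplied. *)
Lemma expansion_step1 (K : numFieldType) (e6 e9 f3 : K) (B C : {poly K}) :
    expansion 1 0 e6 e9 B -> hirota2 C B = 0 -> C`_0 != 0 -> C`_3 = C`_0 * f3 ->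
  expansion 0 f3 (- (7 / 3 * e6)) (- (f3 * e6 + 15 * e9) / 9) C.
Proof.
move=> [b b0 hB] H; move C0: (C`_0) => c c0 C3.
have C1 : C`_1 = 0 by solve_coef (hirota2_coefs 0 H) (- (2 * b)).
have C2 : C`_2 = 0 by solve_coef (hirota2_coefs 1 H) (- (2 * b)).
have C4 : C`_4 = 0 by solve_coef (hirota2_coefs 3 H) (4 * b).
have C5 : C`_5 = 0 by solve_coef (hirota2_coefs 4 H) (10 * b).
have C6 : C`_6 = c * - (7 / 3 * e6) by solve_coef (hirota2_coefs 5 H) (18 * b).
have C7 : C`_7 = 0 by solve_coef (hirota2_coefs 6 H) (28 * b).
have C8 : C`_8 = 0 by solve_coef (hirota2_coefs 7 H) (40 * b).
have C9 : C`_9 = c * (- (f3 * e6 + 15 * e9) / 9).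
  by solve_coef (hirota2_coefs 8 H) (54 * b).
exists c => //; do 10?[case=> [_|]]; last by [].
all: by rewrite /= ?(C0, C1, C2, C3, C4, C5, C6, C7, C8, C9, mulr1, mulr0).
Qed.

Lemma expansion_step2 (K : numFieldType) (e3 e6 e9 : K) (B C : {poly K}) :
    expansion 0 e3 e6 e9 B -> hirota2 C B = 0 -> C`_0 != 0 -> C`_1 = 0 ->
  expansion 0 (- e3) (- (e6 + e3 ^+ 2 / 5)) (- e9) C.
Proof.
move=> [b b0 hB] H; move C0: (C`_0) => c c0 C1.
have C2 : C`_2 = 0 by solve_coef (hirota2_coefs 0 H) (2 * b).
have C3 : C`_3 = c * - e3 by solve_coef (hirota2_coefs 1 H) (6 * b).
have C4 : C`_4 = 0 by solve_coef (hirota2_coefs 2 H) (12 * b).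
have C5 : C`_5 = 0 by solve_coef (hirota2_coefs 3 H) (20 * b).
have C6 : C`_6 = c * - (e6 + e3 ^+ 2 / 5).
  by solve_coef (hirota2_coefs 4 H) (30 * b).
have C7 : C`_7 = 0 by solve_coef (hirota2_coefs 5 H) (42 * b).
have C8 : C`_8 = 0 by solve_coef (hirota2_coefs 6 H) (56 * b).
have C9 : C`_9 = c * - e9 by solve_coef (hirota2_coefs 7 H) (72 * b).
exists c => //; do 10?[case=> [_|]]; last by [].
all: by rewrite /= ?(C0, C1, C2, C3, C4, C5, C6, C7, C8, C9, mulr1, mulr0).
Qed.

(** * Closed forms of the expansions, by residue modulo 3 *)

(** The digit is the residue of [n] modulo 3. The substitution [n -> -1 - n] exchanges the formulas
    for residues 0 and 2 and fixes those for residue 1. *)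
Definition YV_expansion0 (K : fieldType) (n : nat) (p : {poly K}) :=
  let x := n%:R in let e6 := - (x * (x + 3) / 1440) in
  expansion 0 (- (x / 12)) e6 (- (e6 * (x - 3) / 252)) p.

Definition YV_expansion1 (K : fieldType) (n : nat) (p : {poly K}) :=
  let x := n%:R in let e6 := (x - 1) * (x + 2) / 3360 in
  expansion 1 0 e6 (e6 / 60) p.

Definition YV_expansion2 (K : fieldType) (n : nat) (p : {poly K}) :=
  let x := n%:R in let e6 := - ((x + 1) * (x - 2) / 1440) in
  expansion 0 ((x + 1) / 12) e6 (e6 * (x + 4) / 252) p.

Lemma YV_expansion_step1 (K : numFieldType) (n : nat) (A B C : {poly K}) :
    YV_expansion0 n A -> YV_expansion1 n.+1 B ->
    C * A = 'X * B ^+ 2 - 4 * (B * B^`()^`() - B^`() ^+ 2) ->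
    hirota2 C B = 0 ->
  YV_expansion2 n.+2 C.
Proof.
move=> [a a0 hA] hB; have [b b0 hB'] := hB; move=> T H.
have C0 : C`_0 = 4 * b ^+ 2 / a by solve_coef (toda_coefs 0 T) a.
have c0 : C`_0 != 0.
  by rewrite C0 !mulf_neq0 ?invr_eq0 ?expf_eq0 ?pnatr_eq0.
have C1 : C`_1 = 0 by solve_coef (hirota2_coefs 0 H) (- (2 * b)).
have C2 : C`_2 = 0 by solve_coef (hirota2_coefs 1 H) (- (2 * b)).
(* At the indicial exponent 3 the recurrence gives [C_3 / C_0 = 1/4 - e3], where [e3 = - n / 12]
   belongs to [A]. *)
have C3 : C`_3 = C`_0 * ((n.+2%:R + 1) / 12).
  by rewrite C0; solve_coef (toda_coefs 3 T) a.
have := expansion_step1 hB H c0 C3; rewrite /YV_expansion2 /=.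
by congr expansion; field.
Qed.

Lemma YV_expansion_step2 (K : numFieldType) (n : nat) (A B C : {poly K}) :
    YV_expansion1 n A -> YV_expansion2 n.+1 B ->
    C * A = 'X * B ^+ 2 - 4 * (B * B^`()^`() - B^`() ^+ 2) ->
    hirota2 C B = 0 ->
  YV_expansion0 n.+2 C.
Proof.
move=> [a a0 hA] hB; have [b b0 hB'] := hB; move=> T H.
(* Since [A] starts at [X], the coefficient of [X] gives [a C_0 = b^2 (1 - 24 e3)], with
   [e3 = (n + 2) / 12] from [B]. *)
have C0 : C`_0 = - ((2 * n.+1 + 1)%:R * b ^+ 2 / a).
  by solve_coef (toda_coefs 1 T) a.
have c0 : C`_0 != 0.
  by rewrite C0 oppr_eq0 !mulf_neq0 ?invr_eq0 ?expf_eq0 ?pnatr_eq0 ?addn1.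
have C1 : C`_1 = 0 by solve_coef (toda_coefs 2 T) a.
have := expansion_step2 hB H c0 C1; rewrite /YV_expansion0 /=.
by congr expansion; field.
Qed.

Lemma YV_expansion_step0 (K : numFieldType) (n : nat) (A B C : {poly K}) :
    YV_expansion2 n A -> YV_expansion0 n.+1 B ->
    C * A = 'X * B ^+ 2 - 4 * (B * B^`()^`() - B^`() ^+ 2) ->
    hirota2 C B = 0 ->
  YV_expansion1 n.+2 C.
Proof.
move=> [a a0 hA] hB; have [b b0 hB'] := hB; move=> T H.
have C0 : C`_0 = 0 by solve_coef (toda_coefs 0 T) a.
(* Again the factor is [1 - 24 e3], now with [e3 = - (n + 1) / 12]. *)
have C1 : C`_1 = (2 * n.+1 + 1)%:R * b ^+ 2 / a.
  by solve_coef (toda_coefs 1 T) a.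
have c0 : C`_1 != 0.
  by rewrite C1 !mulf_neq0 ?invr_eq0 ?expf_eq0 ?pnatr_eq0 ?addn1.
have := expansion_step0 hB H C0 c0; rewrite /YV_expansion1 /=.
by congr expansion; field.
Qed.

Lemma YV_expansions (K : numFieldType) (Q : nat -> {poly K}) (k : nat) :
    Yablonskii_Vorobev Q ->
  [/\ YV_expansion0 (3 * k) (Q (3 * k)%N),
      YV_expansion1 (3 * k).+1 (Q (3 * k).+1)
    & YV_expansion2 (3 * k).+2 (Q (3 * k).+2)].
Proof.
move=> hQ; have [Q0 Q1 _] := hQ.
have T n := YV_toda n hQ; have H n := YV_hirota2 n hQ.
elim: k => [|k [e0 e1 e2]].
  (* The closed forms vanish at [n = 0] for residue 0 and at [n = 1] for residue 1, matching [1] and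
     ['X]. *)
  have e0 : YV_expansion0 0 (Q 0%N).
    exists 1 => [|i _]; first exact: oner_neq0.
    rewrite Q0 coef1 mul1r mulr0n !(mul0r, oppr0) /=.
    by do 10?[case: i => [|i] //=]; rewrite nth_nil.
  have e1 : YV_expansion1 1 (Q 1%N).
    exists 1 => [|i _]; first exact: oner_neq0.
    rewrite Q1 coefX mul1r mulr1n subrr !mul0r /=.
    by do 11?[case: i => [|i] //=]; rewrite nth_nil.
  by split=> //; apply: YV_expansion_step1 e0 e1 (T 0%N) (H 1%N).
rewrite mulnS !addSn add0n.
have e3 := YV_expansion_step2 e1 e2 (T _) (H _).
have e4 := YV_expansion_step0 e2 e3 (T _) (H _).
by split=> //; apply: YV_expansion_step1 e3 e4 (T _) (H _).
Qed.

(** * Newton's identities for inverse power sums *)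

(** The logarithmic derivative of the product [P] is the sum of [1 / (X - x)], and expanding each
    term in powers of [X] produces the inverse power sums. Modulo [X^N] this becomes a polynomial
    identity, with [r] as the cofactor of [X^N]. *)
Lemma prod_XsubC_logderiv (K : fieldType) (N : nat) (s : seq K) :
    0 \notin s ->
  exists r, (\prod_(x <- s) ('X - x%:P))^`() = 'X^N * r -
    \prod_(x <- s) ('X - x%:P) *
      \poly_(j < N) inverse_power_sum s j.+1.
Proof.
elim: s => [_|x s IHs].
  exists 0; rewrite big_nil mulr0 -polyC1 derivC mul1r sub0r.
  rewrite (_ : \poly_(_ < _) _ = 0) ?oppr0 //; apply/polyP=> i.
  by rewrite coef_poly coef0 /inverse_power_sum big_nil if_same.
rewrite inE negb_or => /andP[x0 /IHs[r Er]].
set p := \prod_(y <- s) _ in Er *; set g := \poly_(j < N) _ in Er.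
rewrite big_cons -/p.
(* [h] is the geometric series of [1 / (x - X)] truncated at order [N]. *)
pose h : {poly K} := \poly_(j < N) (x ^- j.+1).
have -> : \poly_(j < N) inverse_power_sum (x :: s) j.+1 = h + g.
  apply/polyP=> i; rewrite coefD !coef_poly; case: ifP => _; rewrite ?addr0 //.
  by rewrite /inverse_power_sum big_cons eq_sym x0 div1r.
have Eh : ('X - x%:P) * h = 'X^N * (x ^- N)%:P - 1.
  rewrite /h; elim: N {IHs r Er g h} => [|N IHN].
    by rewrite poly_def big_ord0 !expr0 invr1 mulr0 mulr1 subrr.
  rewrite poly_def in IHN.
  rewrite poly_def big_ord_recr mulrDr IHN /= -mul_polyC (exprS 'X).
  have -> : (x ^- N)%:P = x%:P * (x ^- N.+1)%:P.
    by rewrite -polyCM exprS invfM mulrA divff 1?eq_sym // mul1r.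
  ring.
exists (('X - x%:P) * r + (x ^- N)%:P * p).
rewrite derivM derivXsubC Er.
have -> : ('X - x%:P) * p * (h + g) = ('X - x%:P) * h * p + ('X - x%:P) * p * g.
  by ring.
rewrite Eh; ring.
Qed.

Lemma Newton_inverse_power_sum (K : fieldType) (s : seq K) (k : nat) :
    0 \notin s ->
  k.+1%:R * (\prod_(x <- s) ('X - x%:P))`_k.+1 =
    - \sum_(0 <= j < k.+1)
        inverse_power_sum s j.+1 * (\prod_(x <- s) ('X - x%:P))`_(k - j).
Proof.
move=> /(prod_XsubC_logderiv k.+1)[r /(congr1 (fun q : {poly K} => q`_k))].
rewrite coef_deriv mulr_natl => ->.
rewrite coefB coefXnM ltnSn sub0r mulrC coefM big_mkord; congr (- _).
by apply: eq_bigr => j _; rewrite coef_poly ltn_ord.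
Qed.

Lemma expansion_sums (K : numFieldType) (e3 e6 e9 : K) (s : seq K) :
    0 \notin s -> expansion 0 e3 e6 e9 (\prod_(x <- s) ('X - x%:P)) ->
  [/\ inverse_power_sum s 3 = - 3 * e3,
      inverse_power_sum s 6 = 3 * e3 ^+ 2 - 6 * e6 &
      inverse_power_sum s 9 = 9 * e3 * e6 - 3 * e3 ^+ 3 - 9 * e9].
Proof.
move=> s0 [b b0 hB].
have := fun k => Newton_inverse_power_sum k s0.
(* Identity number [k] is linear in [S k.+1] with coefficient [B_0 = b], so the sums are found one
   after another. *)
move: (\prod_(x <- s) _) hB (inverse_power_sum s) => B hB S nS.
have S1 : S 1%N = 0 by solve_coef (nS 0%N) b.
have S2 : S 2%N = 0 by solve_coef (nS 1%N) b.
have S3 : S 3%N = - 3 * e3 by solve_coef (nS 2%N) b.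
have S4 : S 4%N = 0 by solve_coef (nS 3%N) b.
have S5 : S 5%N = 0 by solve_coef (nS 4%N) b.
have S6 : S 6%N = 3 * e3 ^+ 2 - 6 * e6 by solve_coef (nS 5%N) b.
have S7 : S 7%N = 0 by solve_coef (nS 6%N) b.
have S8 : S 8%N = 0 by solve_coef (nS 7%N) b.
have S9 : S 9%N = 9 * e3 * e6 - 3 * e3 ^+ 3 - 9 * e9 by solve_coef (nS 8%N) b.
by [].
Qed.

(** * Power sums over the nonzero roots of the polynomials *)

Lemma expansion_divX (K : fieldType) (m : nat) (e3 e6 e9 l : K) (p q : {poly K}) :
    l != 0 -> p = l *: ('X^m * q) -> expansion m e3 e6 e9 p ->
  expansion 0 e3 e6 e9 q.
Proof.
move=> l0 -> [c c0 hp]; exists (c / l) => [|i lti].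
  by rewrite mulf_neq0 ?invr_eq0.
have := hp (m + i)%N; rewrite ltn_add2l => /(_ lti).
rewrite coefZ coefXnM ltnNge leq_addr nth_cat size_nseq ltnNge leq_addr /=.
by rewrite addKn => e; rewrite mulrAC -e mulrAC divff // mul1r.
Qed.

Lemma expansion_root0 (K : fieldType) (m : nat) (e3 e6 e9 : K) (p : {poly K}) :
  (m <= 1)%N -> expansion m e3 e6 e9 p -> root p 0 = (m == 1%N).
Proof.
move=> m1 [c c0 hp]; rewrite rootE horner_coef0 hp ?addn_gt0 ?orbT //.
by case: m m1 {hp} => [|[]] //= _; rewrite ?mulr1 ?mulr0 ?eqxx ?(negPf c0).
Qed.

(** The roots [r] listed with multiplicity have no repetition, because all roots are simple; hence
    [r] is a permutation of [z]. *)
Lemma YV_prod_roots (K : numClosedFieldType) (Q : nat -> {poly K}) (n : nat)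
    (z : seq K) :
    Yablonskii_Vorobev Q -> enumerates_roots (Q n) z ->
  exists2 l, l != 0 & Q n = l *: \prod_(x <- z) ('X - x%:P).
Proof.
move=> hQ [uz mz]; have [r Er] := closed_field_poly_normal (Q n).
have Q0 : Q n != 0 by have [] := YV_bilinear n hQ.
have l0 : lead_coef (Q n) != 0 by rewrite lead_coef_eq0.
exists (lead_coef (Q n)) => //; rewrite [LHS]Er; congr (_ *: _).
apply/perm_big/uniq_perm => // [|x].
  rewrite -separable_prod_XsubC unlock.
  apply: Pdiv.ClosedField.root_coprimep => x rx.
  by have [_] := YV_coprime_simple n x hQ; rewrite Er derivZ !rootZ // rx.
by rewrite mz Er rootZ // root_prod_XsubC.
Qed.

Lemma YV_inverse_power_sums (K : numClosedFieldType) (Q : nat -> {poly K})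
    (n m : nat) (e3 e6 e9 : K) (z : seq K) :
    Yablonskii_Vorobev Q -> enumerates_roots (Q n) z ->
    (m <= 1)%N -> expansion m e3 e6 e9 (Q n) ->
  [/\ inverse_power_sum z 3 = - 3 * e3,
      inverse_power_sum z 6 = 3 * e3 ^+ 2 - 6 * e6 &
      inverse_power_sum z 9 = 9 * e3 * e6 - 3 * e3 ^+ 3 - 9 * e9].
Proof.
move=> hQ hz m1 hm; have [l l0 El] := YV_prod_roots hQ hz.
pose s := [seq x <- z | x != 0].
have s0 : 0 \notin s by rewrite mem_filter eqxx.
have zs k : inverse_power_sum z k = inverse_power_sum s k.
  rewrite /inverse_power_sum big_filter_cond.
  by apply: eq_bigl => x; rewrite andbb.
rewrite !zs; apply: expansion_sums => //.
apply: (expansion_divX l0 _ hm); rewrite [LHS]El; congr (_ *: _).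
have [uz mz] := hz.
(* The factors of the zero root multiply to ['X^m]: the root 0 is listed once if [m = 1] and not at
   all if [m = 0]. *)
rewrite (bigID (pred1 0)) /= big_filter; congr (_ * _).
have z0 : (0 \in z) = (m == 1%N) by rewrite mz (expansion_root0 m1 hm).
case: m m1 z0 {hm} => [|[]] //= _ z0.
  by rewrite expr0 big1_seq // => x /andP[/eqP ->]; rewrite z0.
by rewrite -big_filter filter_pred1_uniq // big_seq1 subr0 expr1.
Qed.

Lemma YV_power_sums (K : numClosedFieldType) (Q : nat -> {poly K})
    (hQ : Yablonskii_Vorobev Q) (n : nat) (z : seq K)
    (hz : enumerates_roots (Q n) z) :
  [/\ inverse_power_sum z 3 =
        (if (n %% 3)%N == 0%N then n%:R / 4
         else if (n %% 3)%N == 1%N then 0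
         else - ((n%:R + 1) / 4)),
      inverse_power_sum z 6 =
        (if (n %% 3)%N == 0%N then 1 / 40 * n%:R ^+ 2 + 1 / 80 * n%:R
         else if (n %% 3)%N == 1%N then
           - (1 / 560) * n%:R ^+ 2 - 1 / 560 * n%:R + 1 / 280
         else 1 / 40 * n%:R ^+ 2 + 3 / 80 * n%:R + 1 / 80) &
      inverse_power_sum z 9 =
        (if (n %% 3)%N == 0%N then
           (n%:R + 7 * n%:R ^+ 2 + 10 * n%:R ^+ 3) / 4480
         else if (n %% 3)%N == 1%N then
           (2 - n%:R - n%:R ^+ 2) / 22400
         else
           (- 20 - 85 * n%:R - 115 * n%:R ^+ 2 - 50 * n%:R ^+ 3) / 22400)].
Proof.
have sums := YV_inverse_power_sums hQ hz.
have [e0 e1 e2] := YV_expansions (n %/ 3) hQ.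
have En : n = (3 * (n %/ 3) + n %% 3)%N by rewrite mulnC -divn_eq.
have n_mod3 : [\/ n %% 3 = 0%N, n %% 3 = 1%N | n %% 3 = 2%N]%N.
  have := ltn_pmod n (isT : (0 < 3)%N).
  by case: (n %% 3)%N => [|[|[|]]] // _; constructor.
(* Rewriting with these instead of simplifying keeps the large numerals folded. *)
have [n10 n20 n21] :
  [/\ (1%N == 0%N) = false, (2%N == 0%N) = false & (2%N == 1%N) = false].
  by [].
case: n_mod3 => En3; rewrite En3 ?n10 ?n20 ?n21 ?eqxx; rewrite En3 in En.
- rewrite addn0 in En; rewrite -En in e0.
  by have [-> -> ->] := sums 0%N _ _ _ isT e0; split; field.
- rewrite addn1 in En; rewrite -En in e1.
  by have [-> -> ->] := sums 1%N _ _ _ isT e1; split; field.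
- rewrite addn2 in En; rewrite -En in e2.
  by have [-> -> ->] := sums 0%N _ _ _ isT e2; split; field.
Qed.

Theorem mainTheorem5 (R : realType) (Q : nat -> {poly R[i]})
    (hQ : Yablonskii_Vorobev Q) (n : nat) (z : seq R[i])
    (hz : enumerates_roots (Q n) z) :
  [/\ inverse_power_sum z 3 =
        (if (n %% 3)%N == 0%N then n%:R / 4
         else if (n %% 3)%N == 1%N then 0
         else - ((n%:R + 1) / 4)),
      inverse_power_sum z 6 =
        (if (n %% 3)%N == 0%N then 1 / 40 * n%:R ^+ 2 + 1 / 80 * n%:R
         else if (n %% 3)%N == 1%N then
           - (1 / 560) * n%:R ^+ 2 - 1 / 560 * n%:R + 1 / 280
         else 1 / 40 * n%:R ^+ 2 + 3 / 80 * n%:R + 1 / 80) &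
      inverse_power_sum z 9 =
        (if (n %% 3)%N == 0%N then
           (n%:R + 7 * n%:R ^+ 2 + 10 * n%:R ^+ 3) / 4480
         else if (n %% 3)%N == 1%N then
           (2 - n%:R - n%:R ^+ 2) / 22400
         else
           (- 20 - 85 * n%:R - 115 * n%:R ^+ 2 - 50 * n%:R ^+ 3) / 22400)].
Proof. exact: (@YV_power_sums _ Q hQ n z hz). Qed.
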